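(* The bound $D\le \frac{4(n-1)-m}{3}$ for connected planar graphs is best possible up to an additive constant for all possible values of $m$ and $n$: there is a constant $C$ such that for all integers $n\ge 3$ and $m$ with $n-1\le m\le 3n-6$ there exists a finite simple connected planar graph $G$ with exactly $n$ vertices and $m$ edges such that $D(G)\ge \frac{4(n-1)-m}{3}-C$.
   Context: $D(G)$ is the diameter of $G$: the maximum over all pairs of vertices of the distance (minimum number of edges on a path) between them. *)

(* Defs.v *)
From HB Require Import structures.
From mathcomp Require Import all_boot all_order all_algebra.
From mathcomp Require Import all_classical all_reals all_analysis.
Import numFieldNormedType.Exports.

Set Implicit Arguments.
Unset Strict Implicit.
Unset Printing Implicit Defensive.

Record sgraph := SGraph {
  svertex :> finType;
  sadj : rel svertex;
  sadj_sym : symmetric sadj;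
  sadj_irrefl : irreflexive sadj }.

Definition sedges (G : sgraph) : {set {set G}} :=
  [set A : {set G} | [exists x, exists y, sadj x y && (A == [set x; y])]].

Definition sconnected (G : sgraph) : Prop :=
  forall x y : G, connect (@sadj G) x y.

(* The vertex sequence x :: p is a path (no repeated vertex) from x to y;
   it has size p edges. *)
Definition is_path (G : sgraph) (x y : G) (p : seq G) : bool :=
  [&& path (@sadj G) x p, last x p == y & uniq (x :: p)].

(* Least k < #|G| such that some path from x to y has k edges.  A path has at
   most #|G| - 1 edges, so the bound is no restriction; the value is #|G| when
   x and y are not connected. *)
Definition sdist (G : sgraph) (x y : G) : nat :=
  find (fun k => [exists p : k.-tuple G, is_path x y p]) (iota 0 #|G|).

Definition diameter (G : sgraph) : nat :=
  \max_(x : G) \max_(y : G) sdist x y.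

Local Open Scope classical_set_scope.
Local Open Scope ring_scope.

(* A drawing of G in the plane: distinct vertices go to distinct points, each
   edge to an arc (the injective continuous image of [0, 1]) joining its two
   ends, and the interior of an arc contains no vertex and no point of another
   arc. *)
Record plane_drawing (R : realType) (G : sgraph)
    (pos : G -> R * R) (arc : {set G} -> R -> R * R) : Prop := PlaneDrawing {
  drawing_pos_inj : injective pos;
  drawing_arc_cont : forall A, A \in sedges G ->
    {within `[0, 1], continuous (arc A)};
  drawing_arc_inj : forall A, A \in sedges G ->
    {in `[0, 1] &, injective (arc A)};
  drawing_arc_ends : forall A, A \in sedges G ->
    [set arc A 0; arc A 1] = pos @` [set` A];
  drawing_arc_vertex : forall A (s : R) (x : G), A \in sedges G ->
    s \in `]0, 1[ -> arc A s <> pos x;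
  drawing_arc_arc : forall A B (s t : R), A \in sedges G -> B \in sedges G ->
    A != B -> s \in `]0, 1[ -> t \in `[0, 1] -> arc A s <> arc B t }.

Definition planar (R : realType) (G : sgraph) : Prop :=
  exists (pos : G -> R * R) (arc : {set G} -> R -> R * R),
    plane_drawing pos arc.

(* Main.v *)
Require Import Defs.
From HB Require Import structures.
From mathcomp Require Import all_boot all_order all_algebra.
From mathcomp Require Import all_classical all_reals all_analysis.
From mathcomp Require Import zify ring lra.
Import numFieldNormedType.Exports.
Import Order.TTheory GRing.Theory Num.Theory.
Local Open Scope ring_scope.

(** The cube of the path on n vertices (join i and j when |i - j| <= 3) is a
    planar triangulation with 3n - 6 edges and diameter about n / 3.  Keep the
    path and only the first t = m - (n - 1) of the remaining edges, ordered by
    lower endpoint: these lie on about t / 2 initial vertices, which are crossed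
    at speed 3, while the rest of the path is crossed at speed 1, so the
    diameter is about n - t / 3 = (4n - m) / 3.

    For the drawing, put v_(i+3) at the barycenter of v_i, v_(i+1), v_(i+2) and
    use straight segments.  The line through two of v_(i+1), v_(i+2), v_(i+3)
    can be chosen to pass through any prescribed one of them and to separate
    v_i from all later vertices; hence an edge whose lower endpoint is v_i
    meets the edges between later vertices at most at its upper endpoint. *)

(** * Distances as lengths of shortest paths *)

Lemma sdist_path (G : sgraph) (x y : G) : connect (@sadj G) x y ->
  exists2 p, is_path x y p & size p = sdist x y.
Proof.
case/connectP=> p0 /shortenP[p pth_p uniq_p _] ->{p0 y}.
set y := last x p.
pose Q k := [exists q : k.-tuple G, is_path x y q].
have Qp : Q (size p).
  by apply/existsP; exists (in_tuple p); rewrite /is_path pth_p uniq_p eqxx.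
have hasQ : has Q (iota 0 #|G|).
  apply/hasP; exists (size p) => //; rewrite mem_iota add0n.
  by have := card_uniqP uniq_p; have := max_card (mem (x :: p)) => /= + <-.
have : Q (sdist x y).
  have ltd : (sdist x y < #|G|)%N by move: hasQ; rewrite has_find size_iota.
  by have := nth_find 0%N hasQ; rewrite nth_iota.
by case/existsP=> q qP; exists q => //; rewrite size_tuple.
Qed.

(** Summing the growth of [g] along a shortest path; a potential with large variation thus certifies
    a large diameter. *)
Lemma lipschitz_sdist (G : sgraph) (g : G -> nat) (c : nat) :
  (forall x y : G, sadj x y -> (g y <= g x + c)%N) ->
  forall x y : G, connect (@sadj G) x y -> (g y <= g x + c * sdist x y)%N.
Proof.
move=> gL x y /sdist_path[p /and3P[+ /eqP + _] <-].
elim: p x => [|z p IHp] x /=; first by move=> _ ->; lia.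
by case/andP=> /gL xz /IHp zp /zp; lia.
Qed.

Lemma sdist_le_diameter (G : sgraph) (x y : G) : (sdist x y <= diameter G)%N.
Proof. exact: leq_trans (leq_bigmax y) (leq_bigmax (F := fun x => \max_y sdist x y) x). Qed.

(** * The truncated cube of a path: size and diameter *)

Lemma set2_ord_inj (n : nat) (i j k l : 'I_n) : (i < j)%N -> (k < l)%N ->
  [set i; j]%SET = [set k; l]%SET -> i = k /\ j = l.
Proof.
move=> ij kl E.
have /set2P[] : i \in [set k; l]%SET by rewrite -E set21.
all: have /set2P[] : j \in [set k; l]%SET by rewrite -E set22.
all: have /set2P[] : k \in [set i; j]%SET by rewrite E set21.
all: by move=> ? ? ?; subst; split=> //; lia.
Qed.

(* The optional edges (0,2), (0,3), (1,3), (1,4), (2,4), ... of the cube of a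
   path are numbered 0, 1, 2, ...; those numbered below t are kept. *)
Definition cube_arc (t i j : nat) : bool :=
  [|| j == i.+1, (j == i.+2) && (2 * i < t)%N | (j == i.+3) && (2 * i + 1 < t)%N].

Definition cube_adj (t n : nat) : rel 'I_n :=
  fun i j => cube_arc t i j || cube_arc t j i.

Lemma cube_adj_sym t n : symmetric (cube_adj t n).
Proof. by move=> i j; rewrite /cube_adj orbC. Qed.

Lemma cube_adj_irrefl t n : irreflexive (cube_adj t n).
Proof. by move=> i; rewrite /cube_adj /cube_arc; lia. Qed.

Definition cube_graph (t n : nat) : sgraph :=
  SGraph (@cube_adj_sym t n) (@cube_adj_irrefl t n).

Lemma cube_edgeP t n (A : {set 'I_n}) :
  reflect (exists i j : 'I_n, cube_arc t i j /\ A = [set i; j]%SET)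
          (A \in sedges (cube_graph t n)).
Proof.
rewrite inE; apply: (iffP existsP) => [[x /existsP[y /andP[/orP[xy|yx] /eqP->]]]|].
- by exists x, y.
- by exists y, x; rewrite finset.setUC.
case=> i [j [ij ->]]; exists i; apply/existsP; exists j.
by rewrite eqxx andbT /= /cube_adj ij.
Qed.

Lemma cube_connected t n : sconnected (cube_graph t n).
Proof.
case: n => [|n] x y; first by case: x.
have from0 (i : nat) (lti : (i < n.+1)%N) :
    connect (@sadj (cube_graph t n.+1)) ord0 (Ordinal lti).
  elim: i lti => [|i IHi] lti; first by rewrite (_ : Ordinal lti = ord0) //; exact: val_inj.
  apply: connect_trans (IHi (ltnW lti)) (connect1 _).
  by rewrite /= /cube_adj /cube_arc /= eqxx.
have csym : connect_sym (@sadj (cube_graph t n.+1)) by apply/sym_connect_sym/sadj_sym.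
case: x y => [x ltx] [y lty].
by apply: connect_trans (from0 y lty); rewrite csym; exact: from0.
Qed.

(** On [n.+1] vertices there are (n - 1) + (n - 2) optional edges, whence the bound on [t]. *)
Lemma card_cube_edges (n t : nat) : (2 <= n)%N -> (t <= 2 * n - 3)%N ->
  #|sedges (cube_graph t n.+1)| = (n + t)%N.
Proof.
move=> n2 tn.
(* Edge number k, the path edges first: its endpoints are lo k < hi k. *)
pose lo k := if (k < n)%N then k else (k - n)./2.
pose hi k := if (k < n)%N then k.+1 else ((k - n)./2 + (2 + odd (k - n)))%N.
pose f (k : 'I_(n + t)) : {set 'I_n.+1} := [set inord (lo k); inord (hi k)]%SET.
have loh k : (k < n + t)%N -> [/\ (lo k < n.+1)%N, (hi k < n.+1)%N & cube_arc t (lo k) (hi k)].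
  by rewrite /lo /hi /cube_arc; case: ifP => ? ?; split; lia.
have loh_inj k l : lo k = lo l -> hi k = hi l -> k = l.
  by rewrite /lo /hi; case: ifP; case: ifP => *; lia.
have arc_lt i j : cube_arc t i j -> (i < j)%N by rewrite /cube_arc; lia.
have -> : sedges (cube_graph t n.+1) = f @: [set: 'I_(n + t)]%SET.
  apply/finset.setP=> A; apply/cube_edgeP/imsetP.
    case=> i [j [ij ->]].
    have [k [ltk lok hik]] : exists k, [/\ (k < n + t)%N, lo k = i & hi k = j].
      have ltj := ltn_ord j.
      case/or3P: ij => [/eqP E|/andP[/eqP E it]|/andP[/eqP E it]].
      - by exists i; rewrite /lo /hi; split; try case: ifP; lia.
      - by exists (n + 2 * i)%N; rewrite /lo /hi; split; try case: ifP; lia.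
      - by exists (n + 2 * i + 1)%N; rewrite /lo /hi; split; try case: ifP; lia.
    by exists (Ordinal ltk); rewrite ?inE // /f /= lok hik !inord_val.
  case=> k _ ->; have [lok hik kP] := loh _ (ltn_ord k).
  by exists (inord (lo k)), (inord (hi k)); rewrite !inordK.
rewrite card_imset ?cardsT ?card_ord // => k l.
have [lok hik /arc_lt kP] := loh _ (ltn_ord k).
have [lol hil /arc_lt lP] := loh _ (ltn_ord l).
case/set2_ord_inj; rewrite ?inordK // => /(congr1 val) + /(congr1 val).
by rewrite /= !inordK // => /loh_inj H /H /val_inj.
Qed.

(** The potential [g] has slope 1 up to [K], where edges span at most 3, and slope 3 beyond, where
    only path edges remain, so each edge changes it by at most 3. From end to end it gains at least
    3n - 2K, and 2K is at most t + 4. *)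
Lemma cube_diameter (n t : nat) :
  (3 * n <= 3 * diameter (cube_graph t n.+1) + t + 4)%N.
Proof.
(* The optional edges kept only involve the vertices up to K. *)
pose K := (t./2 + 2)%N; pose g (i : cube_graph t n.+1) := (val i + 2 * (val i - K))%N.
have gL (x y : cube_graph t n.+1) : sadj x y -> (g y <= g x + 3)%N.
  by rewrite /= /cube_adj /cube_arc /g /K; case: x y => [x _] [y _] /=; lia.
have := lipschitz_sdist _ _ _ gL _ _ (cube_connected t n.+1 ord0 ord_max).
have := sdist_le_diameter (cube_graph t n.+1) ord0 ord_max.
rewrite /g /K /=; lia.
Qed.

(** * Separating lines for the barycentric spiral *)

Definition segment {R : realType} (p q : R * R) (t : R) : R * R :=
  ((1 - t) * p.1 + t * q.1, (1 - t) * p.2 + t * q.2).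

Lemma segment_continuous (R : realType) (p q : R * R) : continuous (segment p q).
Proof.
have affc (a b : R) : continuous (fun t : R => (1 - t) * a + t * b).
  move=> t; apply: cvgD; apply: cvgM; try exact: cvg_cst; try exact: cvg_id.
  by apply: cvgB; [exact: cvg_cst|exact: cvg_id].
by move=> t; exact: (cvg_pair (affc _ _ t) (affc _ _ t)).
Qed.

Lemma segment0 (R : realType) (p q : R * R) : segment p q 0 = p.
Proof. by case: p => a b; rewrite /segment /=; congr pair; ring. Qed.

Lemma segment1 (R : realType) (p q : R * R) : segment p q 1 = q.
Proof. by case: q => a b; rewrite /segment /=; congr pair; ring. Qed.

Lemma segment_same (R : realType) (p : R * R) (t : R) : segment p p t = p.
Proof. by case: p => a b; rewrite /segment /=; congr pair; ring. Qed.

Definition affine_form {R : realType} (a b c : R) (p : R * R) : R :=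
  a * p.1 + b * p.2 + c.

Lemma affine_form_segment (R : realType) (a b c : R) (p q : R * R) (t : R) :
  affine_form a b c (segment p q t) =
  (1 - t) * affine_form a b c p + t * affine_form a b c q.
Proof. by rewrite /affine_form /segment /=; ring. Qed.

(** The iterated state holds three consecutive points; the oldest one is read off. *)
Definition spiral {R : realType} (i : nat) : R * R :=
  (iter i (fun s : (R * R) * (R * R) * (R * R) =>
     (s.1.2, s.2, ((s.1.1.1 + s.1.2.1 + s.2.1) / 3, (s.1.1.2 + s.1.2.2 + s.2.2) / 3)))
   ((0, 0), (1, 0), (0, 1))).1.1.

Lemma spiralS3 (R : realType) (i : nat) : @spiral R i.+3 =
  (((spiral i).1 + (spiral i.+1).1 + (spiral i.+2).1) / 3,
   ((spiral i).2 + (spiral i.+1).2 + (spiral i.+2).2) / 3).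
Proof. by []. Qed.

Lemma affine_form_spiralS3 (R : realType) (a b c : R) (i : nat) :
  affine_form a b c (spiral i.+3) =
  (affine_form a b c (spiral i) + affine_form a b c (spiral i.+1)
   + affine_form a b c (spiral i.+2)) / 3.
Proof. by rewrite spiralS3 /affine_form /=; field. Qed.

(** Passing from one triangle to the next divides this determinant, twice the signed area, by 3. *)
Lemma spiral_orientation (R : realType) (i : nat) :
  let p := @spiral R i in let q := spiral i.+1 in let r := spiral i.+2 in
  0 < (q.1 - p.1) * (r.2 - p.2) - (r.1 - p.1) * (q.2 - p.2).
Proof.
elim: i => [|i]; first by rewrite /spiral /=; lra.
rewrite spiralS3; move: (spiral i) (spiral i.+1) (spiral i.+2).
by move=> [a b] [c d] [e f] /=; lra.
Qed.

(** Later points are convex combinations of these three. *)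
Lemma affine_form_spiral_ge0 (R : realType) (a b c : R) (i : nat) :
  (forall k, (i < k <= i + 3)%N -> 0 <= affine_form a b c (spiral k)) ->
  forall k, (i < k)%N -> 0 <= affine_form a b c (spiral k).
Proof.
move=> base; elim/ltn_ind=> k IHk ik.
have [k3|k3] := leqP k (i + 3); first by apply: base; rewrite ik.
have -> : k = (k - 3).+3 by lia.
rewrite affine_form_spiralS3; apply: divr_ge0 => //.
by apply: addr_ge0; first apply: addr_ge0; apply: IHk; lia.
Qed.

Lemma spiral_separation (R : realType) (i j : nat) : (i < j <= i + 3)%N ->
  exists a b c : R, [/\ affine_form a b c (spiral i) < 0,
    affine_form a b c (spiral j) = 0
    & forall k, (i < k)%N -> 0 <= affine_form a b c (spiral k)].
Proof.
move=> ij.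
have ex (p q : R * R) : exists a b c : R, forall r : R * R,
    affine_form a b c r = (p.1 - r.1) * (q.2 - r.2) - (q.1 - r.1) * (p.2 - r.2).
  exists (p.2 - q.2), (q.1 - p.1), (p.1 * q.2 - q.1 * p.2).
  by case: p q => [a b] [c d] [e f]; rewrite /affine_form /=; ring.
(* The affine form is a signed area; its zero line is spanned by v_(i+3) and
   v_(i+1) when j = i + 1, and by v_(i+2) and v_(i+3) otherwise. *)
have := spiral_orientation R i.
have [->|ji] := eqVneq j i.+1.
- have [a [b [c E]]] := ex (spiral i.+3) (spiral i.+1).
  move=> o; exists a, b, c; split; [| |apply: affine_form_spiral_ge0 => k kP].
  (* Off its zero line, the form takes the values plus or minus one third of the determinant in [o]
     at the vertices of the triangle. *)
  + rewrite E spiralS3; move: o.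
    move: (spiral i) (spiral i.+1) (spiral i.+2).
    by move=> [? ?] [? ?] [? ?] /=; lra.
  + by rewrite E spiralS3 /=; ring.
  + have : [\/ k = i.+1, k = i.+2 | k = i.+3].
      by move: kP; case: (ltngtP k i.+2) => *; [apply: Or31|apply: Or33|apply: Or32]; lia.
    case=> ->; rewrite E spiralS3; move: o;
    move: (spiral i) (spiral i.+1) (spiral i.+2);
    by move=> [? ?] [? ?] [? ?] /=; lra.
- have [a [b [c E]]] := ex (spiral i.+2) (spiral i.+3).
  move=> o; exists a, b, c; split; [| |apply: affine_form_spiral_ge0 => k kP].
  + rewrite E spiralS3; move: o.
    move: (spiral i) (spiral i.+1) (spiral i.+2).
    by move=> [? ?] [? ?] [? ?] /=; lra.
  + have [->|->] : j = i.+2 \/ j = i.+3 by lia.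
      by rewrite E spiralS3 /=; ring.
    by rewrite E spiralS3 /=; ring.
  + have : [\/ k = i.+1, k = i.+2 | k = i.+3].
      by move: kP; case: (ltngtP k i.+2) => *; [apply: Or31|apply: Or33|apply: Or32]; lia.
    case=> ->; rewrite E spiralS3; move: o;
    move: (spiral i) (spiral i.+1) (spiral i.+2);
    by move=> [? ?] [? ?] [? ?] /=; lra.
Qed.

(** As [s < 1] leaves positive weight on vertex [i], the separating form is negative on the left and
    nonnegative on the right. *)
Lemma spiral_segment_disjoint (R : realType) (i j k l : nat) (s t : R) :
  (i < j <= i + 3)%N -> (i < k)%N -> (i < l)%N -> s < 1 -> 0 <= t <= 1 ->
  segment (spiral i) (spiral j) s <> segment (spiral k) (spiral l) t.
Proof.
move=> ij ik il s1 /andP[t0 t1].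
have [a [b [c [ai aj ak]]]] := spiral_separation R i j ij.
move=> /(congr1 (affine_form a b c)); rewrite !affine_form_segment aj mulr0 addr0.
have : (1 - s) * affine_form a b c (spiral i) < 0 by rewrite pmulr_rlt0 // subr_gt0.
move=> + E; rewrite E ltNge => /negP; apply.
by rewrite addr_ge0 // mulr_ge0 // ?ak // subr_ge0.
Qed.

Lemma spiral_inj (R : realType) : injective (@spiral R).
Proof.
have ne (i k : nat) : (i < k)%N -> @spiral R i <> spiral k.
  move=> ik; have := @spiral_segment_disjoint R i i.+1 k k 0 0.
  by rewrite segment0 segment_same; apply=> //; rewrite ?lexx ?ler01 ?ltr01 //; lia.
move=> i k E; have [ik|ki|//] := ltngtP i k; first by case: (ne _ _ ik).
by case: (ne _ _ ki).
Qed.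

Lemma spiral_segment_vertex (R : realType) (i j k : nat) (s : R) :
  (i < j <= i + 3)%N -> 0 < s < 1 ->
  segment (spiral i) (spiral j) s <> spiral k.
Proof.
move=> ij /andP[s0 s1].
have [ik|ki|<-] := ltngtP i k.
- by rewrite -(segment_same _ (spiral k) 0); apply: spiral_segment_disjoint; rewrite ?lexx ?ler01.
(* An earlier vertex is seen as the start of a segment, and the roles are swapped. *)
- rewrite -(segment0 _ (spiral k) (spiral k.+1)) => /esym.
  by apply: spiral_segment_disjoint; rewrite ?ltr01 ?(ltW s0) ?(ltW s1) //; lia.
have [a [b [c [ai aj _]]]] := spiral_separation R i j ij.
move=> /(congr1 (affine_form a b c)); rewrite affine_form_segment aj.
by have : s * affine_form a b c (spiral i) < 0; [rewrite pmulr_rlt0|lra].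
Qed.

Lemma spiral_segment_inj (R : realType) (i j l : nat) (s t : R) :
  (i < j <= i + 3)%N -> (i < l <= i + 3)%N -> 0 < s -> 0 <= t ->
  segment (spiral i) (spiral j) s = segment (spiral i) (spiral l) t ->
  s = t /\ j = l.
Proof.
(* The form vanishing at vertex [m] compares the weights that the two sides put on vertex [i]; by
   symmetry the parameters agree. *)
have le (m m' : nat) (u v : R) : (i < m <= i + 3)%N -> (i < m')%N -> 0 <= v ->
    segment (spiral i) (spiral m) u = segment (spiral i) (spiral m') v -> v <= u.
  move=> im im' v0 /(congr1 (affine_form _ _ _)) E.
  have [a [b [c [ai am am']]]] := spiral_separation R i m im.
  rewrite -(ler_nM2r ai); have := mulr_ge0 v0 (am' _ im').
  by have := E a b c; rewrite !affine_form_segment am; lra.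
move=> ij il s0 t0 E.
have st : s = t.
  apply/eqP; rewrite eq_le (le j l s t) ?andbT //; last by case/andP: il.
  by apply: (le l j) => //; [case/andP: ij|exact: ltW].
split=> //; apply: (spiral_inj R); subst t.
case: E; case: (spiral j) (spiral l) => [a b] [c d] /= /addrI E1 /addrI E2.
by congr pair; apply: (mulfI (lt0r_neq0 s0)).
Qed.

(** * The plane drawing and the conclusion *)

Definition spiral_arc {R : realType} {n : nat} (A : {set 'I_n}) : R -> R * R :=
  if [pick p : 'I_n * 'I_n | (p.1 < p.2)%N && (A == [set p.1; p.2]%SET)] is Some p
  then segment (spiral p.1) (spiral p.2) else fun=> 0.

Lemma planar_spiral (R : realType) (n : nat) (e : rel 'I_n)
    (e_sym : symmetric e) (eirr : irreflexive e) :
  (forall i j : 'I_n, e i j -> (i < j)%N -> (j <= i + 3)%N) ->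
  planar R (SGraph e_sym eirr).
Proof.
move=> e3; set G := SGraph e_sym eirr.
have arcP (A : {set 'I_n}) : A \in sedges G -> exists i j : 'I_n,
    [/\ (i < j <= i + 3)%N, A = [set i; j]%SET
      & spiral_arc A = segment (@spiral R i) (spiral j)].
  rewrite inE => /existsP[x /existsP[y /andP[/= xy /eqP EA]]].
  rewrite /spiral_arc; case: pickP => [[i j] /= /andP[ij /eqP EA']|none].
    exists i, j; rewrite ij; split=> //; apply: e3 (ij).
    have [[<- <-]//|[<- <-]] : (x = i /\ y = j) \/ (y = i /\ x = j); last by rewrite e_sym.
    have /set2P xE : x \in [set i; j]%SET by rewrite -EA' EA set21.
    have /set2P yE : y \in [set i; j]%SET by rewrite -EA' EA set22.
    by case: xE yE xy => -> [] ->; rewrite ?eirr // => _; tauto.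
  have [xy'|yx|/val_inj xy'] := ltngtP x y.
  - by have := none (x, y); rewrite /= xy' EA eqxx.
  - by have := none (y, x); rewrite /= yx EA finset.setUC eqxx.
  - by move: xy; rewrite xy' eirr.
exists (fun i : 'I_n => spiral i), spiral_arc; split.
- by move=> i j /spiral_inj /val_inj.
- move=> A /arcP[i [j [_ _ ->]]]; apply: continuous_subspaceT.
  exact: segment_continuous.
- move=> A /arcP[i [j [ij _ ->]]] s t; rewrite !in_itv /= => /andP[s0 s1] /andP[t0 t1].
  have [s_gt0|s_le0] := ltP 0 s; first by case/spiral_segment_inj.
  have [t_gt0 /esym|t_le0 _] := ltP 0 t; first by case/spiral_segment_inj.
  by lra.
- move=> A /arcP[i [j [ij -> ->]]]; rewrite segment0 segment1.
  apply/seteqP; split=> [p [->|->]|p [k /set2P[->|->] <-]]; last 2 first.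
  + by left.
  + by right.
  + by exists i => //=; rewrite set21.
  + by exists j => //=; rewrite set22.
- move=> A s x /arcP[i [j [ij _ ->]]]; rewrite in_itv /= => s01.
  exact: spiral_segment_vertex.
- move=> A B s t /arcP[i [j [ij EA ->]]] /arcP[k [l [kl EB ->]]] AB.
  rewrite !in_itv /= => s01 t01.
  have [s0 s1] := andP s01; have [t0 t1] := andP t01.
  have [ik|ki|/val_inj ik] := ltngtP i k.
  + by apply: spiral_segment_disjoint => //; lia.
  (* Now the second arc has the lower starting vertex; its closed end [t = 1] is a vertex and needs
     separate treatment. *)
  + have [t_lt1|t_ge1] := ltP t 1.
      move/esym; apply: spiral_segment_disjoint => //; try lia.
      by rewrite !ltW.
    have -> : t = 1 by lra.
    by rewrite segment1; apply: spiral_segment_vertex.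
  + subst k => /spiral_segment_inj[] // _ /val_inj jl.
    by move: AB; rewrite EA EB jl eqxx.
Qed.

Theorem mainTheorem4 (R : realType) :
  exists C : R, forall n m : nat,
    (3 <= n)%N -> (n - 1 <= m)%N -> (m <= 3 * n - 6)%N ->
    exists G : sgraph,
      [/\ sconnected G, planar R G, #|G| = n, #|sedges G| = m
        & (4 * (n%:R - 1) - m%:R) / 3 - C <= (diameter G)%:R].
Proof.
(* From here [n] is the number of path edges. The diameter bound loses 4/3, which 2 covers. *)
exists 2 => -[//|n] m n3 nm mn; pose t := (m - n)%N.
exists (cube_graph t n.+1); split.
- exact: cube_connected.
- by apply: planar_spiral => i j; rewrite /cube_adj /cube_arc; lia.
- exact: card_ord.
- by rewrite card_cube_edges /t; lia.
- have : (4 * n <= 3 * diameter (cube_graph t n.+1) + m + 4)%N.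
    by have := cube_diameter n t; rewrite /t; lia.
  by rewrite -(ler_nat R) (natrD _ _ 4) (natrD _ _ m) !natrM -natr1; lra.
Qed.
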